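(* Let $p > 2$ be a prime and let $K \geq 8$ be a real number. Then $$F(p,K) \;\leq\; \frac{p^{2K-2}}{2K-1}.$$
   Context: For $r \in \mathbb{N}$ write $\mathbb{Z}_r = \mathbb{Z}/r\mathbb{Z}$. For subsets $A, B$ of an abelian group, $A+B = \{a+b : a \in A,\ b \in B\}$. For a non-empty subset $A$ of a finite abelian group, $\langle A \rangle$ denotes the affine span of $A$, i.e. the smallest subgroup or coset of a subgroup containing $A$. For $r \in \mathbb{N}$ and real $K \geq 1$ define $$F(r,K) = \sup\left\{ \frac{|\langle A\rangle|}{|A|} \;:\; n \in \mathbb{N},\ \emptyset \neq A \subseteq \mathbb{Z}_r^n,\ \frac{|A+A|}{|A|} \leq K \right\}.$$ *)

(* Defs.v *)
From mathcomp Require Import all_boot all_order all_algebra fingroup.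
From mathcomp Require Import all_classical all_reals all_analysis.

Set Implicit Arguments.
Unset Strict Implicit.
Unset Printing Implicit Defensive.

Import Order.TTheory GRing.Theory Num.Theory.
Local Open Scope ring_scope.

(* MathComp views a [finZmodType] as a finite group written multiplicatively,
   whose law is [+%R]; thus [{group G}] is the type of (additive) subgroups. *)

Definition sumset (G : finZmodType) (A B : {set G}) : {set G} :=
  [set a + b | a in A, b in B]%SET.

(* Cosets of subgroups; subgroups themselves are included, with [x = 0]. *)
Definition is_coset (G : finZmodType) (C : {set G}) : bool :=
  [exists H : {group G}, exists x : G, C == [set x + h | h in H]%SET].

Definition affine_span (G : finZmodType) (A : {set G}) : {set G} :=
  (\bigcap_(C : {set G} | is_coset C && (A \subset C)) C)%SET.

(* The intersection above is itself a coset when [A] is non-empty, so that it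
   is the smallest coset containing [A]. *)
Lemma affine_span_least (G : finZmodType) (A : {set G}) (a0 : G) :
    a0 \in A ->
  [/\ is_coset (affine_span A), A \subset affine_span A &
      forall C : {set G}, is_coset C -> A \subset C -> affine_span A \subset C].
Proof.
move=> Aa0; split; last 2 first.
- by apply/finset.bigcapsP => C /andP[].
- by move=> C cC sAC; apply: (finset.bigcap_inf C); rewrite cC.
pose P (K : {group G}) := A \subset [set a0 + h | h in K]%SET.
pose H : {group G} := bigcap_group P id.
apply/existsP; exists H; apply/existsP; exists a0; apply/eqP/setP => y.
apply/finset.bigcapP/imsetP => [yP | [h hH ->] C /andP[]].
  exists (y - a0); last by rewrite addrC subrK.
  apply/finset.bigcapP => K sAK.
  have /yP /imsetP[k kK ->] : is_coset [set a0 + h | h in K]%SET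
      && (A \subset [set a0 + h | h in K]%SET).
    by rewrite [_ \subset _]sAK andbT; apply/existsP; exists K; apply/existsP; exists a0.
  by rewrite addrC addKr.
case/existsP=> K /existsP[x /eqP ->] sAC.
have xKE : [set x + h | h in K]%SET = [set a0 + h | h in K]%SET.
  have /imsetP[k kK a0E] := fintype.subsetP sAC _ Aa0.
  apply/setP => z; apply/imsetP/imsetP => -[l lK ->].
    exists (- k + l); last by rewrite a0E -addrA addNKr.
    by rewrite (@groupM _ K (- k) l) ?(@groupVr _ K k).
  by exists (k + l); rewrite ?(@groupM _ K k l) // a0E addrA.
rewrite xKE in sAC *; apply/imsetP; exists h => //.
by move/finset.bigcapP: hH => ->.
Qed.

(* The supremum is taken in the extended reals, so that it is meaningful
   without knowing beforehand that the set is bounded.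
   Beware that ['Z_r] is Z/rZ only for [r >= 2]. *)
Definition F (R : realType) (r : nat) (K : R) : \bar R :=
  ereal_sup [set q : \bar R | exists (n : nat) (A : {set 'rV['Z_r]_n}),
    [/\ A != finset.set0,
        #|sumset A A|%:R / #|A|%:R <= K &
        q = (#|affine_span A|%:R / #|A|%:R)%:E]]%classic.

(* Main.v *)
Require Import Defs.
From mathcomp Require Import all_classical all_reals all_analysis.
From mathcomp Require Import all_boot all_order all_algebra fingroup.
From mathcomp Require Import zify ring lra.
Set Implicit Arguments.
Unset Strict Implicit.
Unset Printing Implicit Defensive.
Import Order.TTheory GRing.Theory Num.Theory.
Local Open Scope set_scope.
Local Open Scope ring_scope.

(** A translate of [A] spans a space F_p^n, and after a linear change of
    coordinates it contains the frame 0, e_0, ..., e_(n-1).  Fix such a set.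

    Compression.  Let v = e_j - y, where y is a point of [A] whose coordinates
    from the j-th on vanish.  On each line of direction v, push the points of
    [A] down to an initial segment for the j-th coordinate.  The size of [A] is
    unchanged, by Cauchy-Davenport the sumset does not grow
    ([card_sumset_compress]), and no point of the frame is lost, because e_j
    lies on the same line as y, which is also in [A].  Read the coordinates as
    base-p digits: a compression that moves a point lowers the sum of these
    numbers over [A], so a set minimising it is fixed by all these compressions
    ([exists_stable]): if x is in [A], x_j <> 0 and y is as above, then
    x - e_j + y is in [A].

    Structure.  Write V_k for the span of e_0, ..., e_(k-1), and
    A_k = A :&: V_k.  As soon as A_k <> V_k, stability forces A_(k+1) to be A_k
    together with e_k + T for some T inside the stabilizer of A_k
    ([layer_recurrence]).  If [A] is not the whole space, let j be the largest
    index with A_j = V_j and put q = |V_j| = p^j.  Then A_(j+1) is explicit up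
    to its last level ([first_layer]), and summing the recurrence over the m
    remaining coordinates ([upper_layers]) gives, for b = |A_(j+1)|,
    s0 = |A_(j+1) + A_(j+1)|, w = |Stab A_(j+1)| and some t <= m w,

      |A| = b + t   and   2 |A + A| >= 2 s0 + 2 m b + (m + 1) t.

    Estimate.  Here n = j + 1 + m, so with X = 2K - 3 - m the theorem reads
    q (2K - 1) <= p^X |A|.  The two relations bound X |A| from below, and
    p >= 3 > e gives p^X >= 1 + X + X^2/4, which is enough for m >= 8.  For
    m <= 7 the hypothesis K >= 8 forces X >= 6, and |A| >= q suffices
    ([density_estimate]).  Equality holds for a subspace together with
    its translates by vectors independent modulo it. *)

(** * Sumsets in the prime field *)

Lemma ltn_Fp (p : nat) (x : 'F_p) : prime p -> (x < p)%N.
Proof. by move=> pp; apply: leq_trans (ltn_ord x) _; rewrite Fp_cast. Qed.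

Lemma val_FpD p (x y : 'F_p) : prime p -> (x + y)%R = ((x + y) %% p)%N :> nat.
Proof. by move=> pp; exact: (congr1 (modn (x + y)%N) (Fp_cast pp)). Qed.

Lemma mem_sumset (G : finZmodType) (X Y : {set G}) x y :
  x \in X -> y \in Y -> x + y \in sumset X Y.
Proof. by move=> Xx Yy; apply/imset2P; exists x y. Qed.

Section CauchyDavenport.
Variables (p : nat) (p_prime : prime p).
Implicit Types X Y : {set 'F_p}.

Lemma set_shift_full X d x0 : x0 \in X -> d != 0 ->
  (forall x, x \in X -> x + d \in X) -> X = [set: 'F_p].
Proof.
move=> Xx0 d0 Xd; apply/setP => z; rewrite inE.
have key k : x0 + d *+ k \in X.
  by elim: k => [|k IH]; rewrite ?addr0 // mulrSr addrA; apply: Xd.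
have -> : z = x0 + d *+ ((z - x0) / d : 'F_p).
  by rewrite -mulr_natr natr_Zp mulrC divfK // subrKC.
exact: key.
Qed.

(** Dyson's e-transform, by induction on the size of [Y]: replace [X] and [Y]
    by [X :|: (e + Y)] and [Y :&: (X - e)].  This keeps the sum of the sizes
    and shrinks the sumset.  If no [e] in [X - Y] shrinks [Y], then [X] is
    invariant under all differences of [Y], so [X] is the whole field unless
    [Y] is a single point. *)
Lemma cauchy_davenport X Y : X != set0 -> Y != set0 ->
  (minn p (#|X| + #|Y|).-1 <= #|sumset X Y|)%N.
Proof.
have [m] := ubnP #|Y|; elim: m X Y => // m IH X Y leYm X0 Y0.
have [/existsP[x /andP[Xx]]|] :=
  boolP [exists x in X, [exists y in Y, [exists y' in Y, x - y + y' \notin X]]].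
  case/existsP=> y /andP[Yy] /existsP[y' /andP[Yy' nX]].
  pose e := x - y.
  pose Y1 := [set z in Y | e + z \in X].
  pose X1 := X :|: [set e + z | z in Y].
  have cE : (#|X1| + #|Y1| = #|X| + #|Y|)%N.
    rewrite cardsU.
    have -> : X :&: [set e + z | z in Y] = [set e + z | z in Y1].
      apply/setP => z; rewrite inE; apply/andP/imsetP.
        by case=> Xz /imsetP[t Yt zE]; exists t => //; rewrite inE Yt -zE.
      by case=> t; rewrite inE => /andP[Yt Xt] ->; split => //; apply: imset_f.
    rewrite !card_imset; try exact: addrI.
    have : (#|Y1| <= #|Y|)%N.
      by apply/subset_leq_card/fintype.subsetP => z; rewrite inE => /andP[].
    by move/(leq_trans)/(_ (leq_addl #|X| _))/subnK.
  have Y1Y : (#|Y1| < #|Y|)%N.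
    apply: proper_card; apply/properP; split.
      by apply/fintype.subsetP => z; rewrite inE => /andP[].
    by exists y' => //; rewrite inE Yy'.
  have Y10 : Y1 != set0 by apply/set0Pn; exists y; rewrite inE Yy subrK.
  have X10 : X1 != set0 by apply/set0Pn; exists x; rewrite inE Xx.
  have := IH X1 Y1 (leq_trans Y1Y leYm) X10 Y10; rewrite cE => /leq_trans; apply.
  apply/subset_leq_card/fintype.subsetP => z /imset2P[a b]; rewrite !inE.
  move=> + /andP[Yb Xb] ->; case/orP=> [Xa|/imsetP[c Yc ->]].
    exact: mem_sumset.
  by rewrite addrAC mem_sumset.
rewrite negb_exists => /forallP XY.
have {}XY x y y' : x \in X -> y \in Y -> y' \in Y -> x - y + y' \in X.
  move=> Xx Yy Yy'; apply: contraNT (XY x) => h.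
  rewrite Xx; apply/existsP; exists y; rewrite Yy; apply/existsP; exists y'.
  by rewrite Yy'.
have [x0 Xx0] := set0Pn _ X0; have [y0 Yy0] := set0Pn _ Y0.
have [/eqP Y1|Yn1] := boolP (#|Y| == 1%N).
  rewrite Y1 addn1 /= geq_min; apply/orP; right.
  rewrite -(card_imset (mem X) (addIr y0)); apply/subset_leq_card.
  by apply/fintype.subsetP => z /imsetP[x Xx ->]; apply: mem_sumset.
have [y1 Yy1 y10] : exists2 y1, y1 \in Y & y1 != y0.
  have : (0 < #|Y :\ y0|)%N by have := cardsD1 y0 Y; rewrite Yy0; lia.
  by case/card_gt0P=> y1; rewrite !inE => /andP[? ?]; exists y1.
have XT : X = [set: 'F_p].
  apply: (@set_shift_full _ (y1 - y0) x0) => //; first by rewrite subr_eq0.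
  by move=> x Xx; rewrite addrA addrAC XY.
suff -> : sumset X Y = [set: 'F_p] by rewrite cardsT card_Fp // geq_minl.
apply/setP => z; rewrite inE -(subrK y0 z) mem_sumset // XT inE //.
Qed.
End CauchyDavenport.

(** * Compression along a direction *)

Section Compression.
Variables (p n : nat) (p_prime : prime p).
Local Notation V := 'rV['F_p]_n.
Variables (j : 'I_n) (v : V) (vj1 : v 0 j = 1).
Implicit Types (A B : {set V}) (x y w : V).

(** The line of direction [v] through [x] is parametrised by its [j]-th
    coordinate, so that [fiber A x] depends on that line only. *)
Definition fiber A (x : V) : {set 'F_p} :=
  [set t | x - x 0 j *: v + t *: v \in A].

Definition compress A : {set V} := [set x : V | (x 0%R j < #|fiber A x|)%N].

Lemma fiber_shift A x t : fiber A (x + t *: v) = fiber A x.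
Proof.
apply/setP => s; rewrite !inE !mxE vj1 mulr1 scalerDl opprD addrACA subrr.
by rewrite addr0.
Qed.

Lemma mem_fiber A x : (x 0 j \in fiber A x) = (x \in A).
Proof. by rewrite inE subrK. Qed.

Lemma card_fiber_le A x : (#|fiber A x| <= p)%N.
Proof. by apply: leq_trans (max_card _) _; rewrite card_Fp. Qed.

Lemma sum_fiber (th : V -> nat) A : (forall x t, th (x + t *: v)%R = th x) ->
  (\sum_(x in A) th x = \sum_(w : V | (w 0 j == 0)%R) #|fiber A w| * th w)%N.
Proof.
move=> thv.
rewrite (partition_big (fun x : V => x - x 0 j *: v) (fun w : V => w 0 j == 0))
  => [|x _]; last by rewrite !mxE vj1 mulr1 subrr.
apply: eq_bigr => w /eqP w0.
rewrite (reindex_onto (fun t : 'F_p => w + t *: v) (fun x : V => x 0 j));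
  last by move=> x /andP[_ /eqP <-]; rewrite subrK.
rewrite -sum_nat_const; apply: eq_big => [t|t _]; last exact: thv.
rewrite !inE w0 scale0r subr0 !mxE vj1 mulr1 w0 add0r eqxx andbT addrK eqxx.
by rewrite andbT.
Qed.

Lemma card_fiber_compress A x : #|fiber (compress A) x| = #|fiber A x|.
Proof.
have le_p : (#|fiber A x| <= (Zp_trunc (pdiv p)).+2)%N.
  by apply: leq_trans (max_card _) _; rewrite card_ord.
have -> : fiber (compress A) x = [set t : 'F_p | (t < #|fiber A x|)%N].
  apply/setP => t; rewrite !inE -addrA -scaleNr -scalerDl.
  by rewrite fiber_shift !mxE vj1 mulr1 addrA subrr add0r.
rewrite -sum1_card (eq_bigl (fun t : 'F_p => (t < #|fiber A x|)%N));
  last by move=> t; rewrite inE.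
by rewrite (big_ord_narrow (F := fun _ => 1%N) le_p) sum1_card card_ord.
Qed.

Lemma sum_compress (th : V -> nat) A : (forall x t, th (x + t *: v)%R = th x) ->
  (\sum_(x in compress A) th x = \sum_(x in A) th x)%N.
Proof.
move=> thv; rewrite !sum_fiber //; apply: eq_bigr => w _.
by rewrite card_fiber_compress.
Qed.

Lemma card_compress A : #|compress A| = #|A|.
Proof. by rewrite -!sum1_card; apply: (@sum_compress (fun=> 1%N)). Qed.

(** On fibers this is Cauchy-Davenport: the initial segments of lengths [a] and
    [b] have a sumset of size [min p (a + b - 1)], which no two sets of these
    sizes can beat. *)
Lemma sumset_compress A B :
  sumset (compress A) (compress B) \subset compress (sumset A B).
Proof.
apply/fintype.subsetP => z /imset2P[x y]; rewrite !inE => xA yB ->.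
have : (minn p (#|fiber A x| + #|fiber B y|).-1
        <= #|sumset (fiber A x) (fiber B y)|)%N.
  by apply: cauchy_davenport => //; rewrite -card_gt0;
    [apply: leq_ltn_trans xA | apply: leq_ltn_trans yB].
have : sumset (fiber A x) (fiber B y) \subset fiber (sumset A B) (x + y).
  apply/fintype.subsetP => s /imset2P[t u]; rewrite !inE => tA uB ->.
  rewrite !mxE !scalerDl opprD (addrACA x) (addrACA (x - _)).
  exact: mem_sumset.
move/subset_leq_card => h1 h2; apply: leq_trans (leq_trans h2 h1).
rewrite mxE val_FpD // leq_min ltn_mod prime_gt0 //=.
apply: leq_ltn_trans (leq_mod _ _) _.
by have := leq_add xA yB; rewrite addSn addnS; case: (_ + #|_|)%N.
Qed.

Lemma card_sumset_compress A :
  (#|sumset (compress A) (compress A)| <= #|sumset A A|)%N.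
Proof.
by rewrite -(card_compress (sumset A A)) subset_leq_card ?sumset_compress.
Qed.

Lemma compress0 A x : x \in A -> x 0 j = 0 -> x \in compress A.
Proof.
move=> Ax x0; rewrite inE x0; apply/card_gt0P; exists (x 0 j).
by rewrite mem_fiber.
Qed.

(** A point at level one survives if the point below it on its line is
    present: the fiber then has two elements. *)
Lemma compress1 A x : x \in A -> x - v \in A -> x 0 j = 1 -> x \in compress A.
Proof.
move=> Ax Axv x1; rewrite inE x1; apply/card_gt1P; exists 1, 0.
by rewrite !inE x1 scale1r scale0r addr0 subrK Axv Ax oner_eq0.
Qed.

(** Within a line, the threshold [th] separates the points that a compression
    adds, which lie below it, from those that it removes.  As both kinds are
    equally many on each line, [th] has the same total over them, and this
    compares the two sums of [N]. *)
Lemma sum_compress_lt (N : V -> nat) A :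
  (forall x t, (x 0%R j < (x 0 j + t)%R)%N -> (N x < N (x + t *: v)%R)%N) ->
  compress A != A ->
  (\sum_(x in compress A) N x < \sum_(x in A) N x)%N.
Proof.
move=> Nv CA; set C := compress A.
pose th (x : V) := N (x - x 0 j *: v + (#|fiber A x|%:R : 'F_p) *: v).
have thv x t : th (x + t *: v) = th x.
  rewrite /th fiber_shift !mxE vj1 mulr1 scalerDl opprD addrACA subrr.
  by rewrite addr0.
have thlt x : x \in C -> x \notin A -> (N x < th x)%N.
  rewrite inE => xC xA.
  rewrite /th -addrA -scaleNr -scalerDl; apply: Nv.
  rewrite addNKr.
  have lp : (#|fiber A x| < p)%N.
    rewrite ltn_neqAle card_fiber_le andbT; apply: contra xA => /eqP fE.
    rewrite -mem_fiber; suff -> : fiber A x = [set: 'F_p] by rewrite inE.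
    by apply/eqP; rewrite eqEcard finset.subsetT cardsT card_Fp // fE leqnn.
  by rewrite /= val_Fp_nat // modn_small.
have thge x : x \in A -> x \notin C -> (th x <= N x)%N.
  rewrite inE -leqNgt => xA xC.
  have [E|ne] := eqVneq (x 0 j : nat) #|fiber A x|.
    by rewrite /th -E natr_Zp subrK.
  have lt : (#|fiber A x| < x 0%R j)%N by rewrite ltn_neqAle eq_sym ne.
  rewrite ltnW // -{2}[x](subrK (x 0 j *: v)) /th.
  set y := _ + _ *: v.
  have -> : x - x 0 j *: v + x 0 j *: v
     = y + (x 0 j - #|fiber A x|%:R : 'F_p) *: v.
    by rewrite /y scalerBl [RHS]addrACA subrr addr0.
  apply: Nv; rewrite {}/y !mxE vj1 !mulr1 subrr add0r addrC subrK.
  by rewrite /= val_Fp_nat // modn_small // (ltn_trans lt) // ltn_Fp.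
have [x0 Cx0 nAx0] : exists2 x0, x0 \in C & x0 \notin A.
  apply/subsetPn; apply: contra CA => CA.
  by rewrite eqEcard CA card_compress leqnn.
have split (S T : {set V}) (g : V -> nat) :
    (\sum_(x in S) g x = \sum_(x in S :&: T) g x + \sum_(x in S :\: T) g x)%N.
  exact: big_setID.
rewrite (split C A) (split A C) setIC ltn_add2l.
have := sum_compress A thv; rewrite (split (compress A) A) (split A C) -/C setIC.
move/addnI => E.
apply: (@leq_trans (\sum_(x in C :\: A) th x)).
  rewrite (bigD1 x0) /=; last by rewrite inE nAx0.
  rewrite [X in (_ < X)%N](bigD1 x0) /=; last by rewrite inE nAx0.
  rewrite -addSn leq_add ?thlt //; apply: leq_sum => x.
  by rewrite inE => /andP[/andP[nA xC] _]; rewrite ltnW // thlt.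
by rewrite E; apply: leq_sum => x; rewrite inE => /andP[nC xA]; apply: thge.
Qed.
End Compression.

(** * Stable sets *)

Section Stable.
Variables (p n : nat) (p_prime : prime p).
Local Notation V := 'rV['F_p]_n.
Implicit Types (A B X : {set V}) (x y h : V) (i : 'I_n) (j : nat).

Definition basis_vec i : V := delta_mx 0 i.
Local Notation e := basis_vec.

Lemma basis_vecE i i' : e i 0 i' = (i' == i)%:R.
Proof. by rewrite mxE eqxx. Qed.

Definition framed A := (0 \in A) && [forall i, e i \in A].

(** The standard flag: [low j] is the span of the first [j] basis vectors. *)
Definition low j : {set V} :=
  [set x : V | [forall i : 'I_n, (j <= i)%N ==> (x 0%R i == 0%R)]].

Lemma lowP j x :
  reflect (forall i : 'I_n, (j <= i)%N -> x 0 i = 0) (x \in low j).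
Proof.
rewrite inE; apply: (iffP forallP) => xj i.
  by move=> ji; apply/eqP; move: (xj i); rewrite ji.
by apply/implyP => ji; apply/eqP; apply: xj.
Qed.

(** Being fixed by all compressions along [e_j - y], with [y] in [A] and in
    [low j]. *)
Definition stable A := forall (j : 'I_n) x y,
  x \in A -> x 0 j != 0 -> y \in A -> y \in low j -> x - e j + y \in A.

(** The coordinates read as base-[p] digits, the last one leading: this orders
    the points lexicographically from the top coordinate. *)
Definition weight x : nat := (\sum_(i < n) x 0%R i * p ^ i)%N.

Lemma sum_digits_lt (d : 'I_n -> nat) k : (forall i, d i < p)%N ->
  (\sum_(i < n | (i < k)%N) d i * p ^ i < p ^ k)%N.
Proof.
move=> dp; elim: k => [|k IH]; first by rewrite big_pred0.
rewrite (bigID (fun i : 'I_n => i == k :> nat)) /= addnC expnS.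
rewrite (eq_bigl (fun i : 'I_n => (i < k)%N)) => [|i]; last first.
  by rewrite ltnS andbC -ltn_neqAle.
have dk : (\sum_(i < n | (i < k.+1)%N && (i == k :> nat)) d i * p ^ i
            <= p.-1 * p ^ k)%N.
  have [kn|nk] := ltnP k n; last first.
    rewrite big_pred0 // => i; rewrite andbC; case: eqP => // ik.
    by have := ltn_ord i; rewrite ik ltnNge nk.
  rewrite (big_pred1 (Ordinal kn)) => [|i]; last first.
    by rewrite /= -[RHS]val_eqE /= andbC; case: eqP => //= ->; rewrite ltnSn.
  by rewrite leq_mul2r -ltnS prednK ?prime_gt0 // dp orbT.
have := leq_add IH dk; rewrite addSn -mulSn prednK // prime_gt0 //.
Qed.

Lemma weight_lt (j : 'I_n) x y :
    (forall i, (j < i)%N -> x 0 i = y 0 i) ->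
  (x 0%R j < y 0%R j)%N -> (weight x < weight y)%N.
Proof.
move=> xy ltj.
have split z : weight z = (\sum_(i < n | (i < j)%N) z 0%R i * p ^ i
     + z 0%R j * p ^ j + \sum_(i < n | (j < i)%N) z 0%R i * p ^ i)%N.
  rewrite /weight (bigID (fun i : 'I_n => (i < j)%N)) /= -addnA; congr addn.
  rewrite (bigD1 j) ?ltnn //=; congr addn; apply: eq_bigl => i.
  by rewrite -leqNgt (ltn_neqAle j) eq_sym andbC.
rewrite !split; rewrite [X in (_ < _ + X)%N](eq_bigr (fun i => x 0%R i * p ^ i)%N);
  last by move=> i ji; rewrite xy.
rewrite ltn_add2r.
apply: (@leq_trans (p ^ j + x 0%R j * p ^ j)%N).
  rewrite ltn_add2r.
  by apply: sum_digits_lt => i; apply: ltn_Fp.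
rewrite -mulSn; apply: leq_trans (leq_addl _ _); rewrite leq_mul2r ltj orbT //.
Qed.

(** A set of least total weight among the framed sets with the size of [A] and
    no larger sumset.  A compression along [e_j - y] leaves the coordinates
    above [j] alone, so it would lower the total weight if it moved anything. *)
Lemma exists_stable A : framed A ->
  exists B, [/\ framed B, #|B| = #|A|, (#|sumset B B| <= #|sumset A A|)%N
    & stable B].
Proof.
move=> fA.
pose P B := [&& framed B, #|B| == #|A| & (#|sumset B B| <= #|sumset A A|)%N].
pose W B := (\sum_(x in B) weight x)%N.
have PA : P A by rewrite /P fA eqxx leqnn.
case: (arg_minnP W PA) => B /and3P[fB /eqP cB sB] minB.
exists B; split=> // j x y Bx xj By yj.
pose v := e j - y.
have vj1 : v 0 j = 1 by rewrite mxE basis_vecE mxE (lowP _ _ yj) // eqxx subr0.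
have vgt i : (j < i)%N -> v 0 i = 0.
  move=> ji; rewrite mxE basis_vecE mxE (lowP _ _ yj) 1?ltnW // subr0.
  by case: eqP ji => // ->; rewrite ltnn.
have shiftE z t i : (z + t *: v) 0 i = z 0 i + t * v 0 i by rewrite !mxE.
have /andP[B0 /forallP Be] := fB.
have CB : compress j v B = B.
  apply/eqP; apply: contraT => /(sum_compress_lt p_prime vj1) lt.
  suff /minB : P (compress j v B).
    rewrite leqNgt => /negP[]; apply: lt => z t lt; apply: (@weight_lt j).
      by move=> i ji; rewrite shiftE vgt // mulr0 addr0.
    by rewrite shiftE vj1 mulr1.
  rewrite /P card_compress // cB eqxx /=.
  rewrite (leq_trans (card_sumset_compress _ _ _)) // andbT.
  apply/andP; split; first by rewrite compress0 // mxE.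
  apply/forallP => i; have [->|ij] := eqVneq i j.
    by rewrite compress1 ?Be // ?basis_vecE ?eqxx // /v opprB addrC subrK.
  by rewrite compress0 // basis_vecE eq_sym (negPf ij).
have -> : x - e j + y = x - v by rewrite /v opprB addrAC addrA.
have lt0 : (0 < x 0%R j)%N by rewrite lt0n.
rewrite -CB inE -scaleN1r fiber_shift // shiftE vj1 mulr1.
move: Bx; rewrite -{1}CB inE; apply: leq_trans.
have -> : x 0 j - 1 = ((x 0%R j).-1%:R : 'F_p).
  by rewrite -subn1 natrB // natr_Zp.
rewrite val_Fp_nat // modn_small ?prednK //.
by rewrite ltnW // ltn_Fp.
Qed.
End Stable.

(** * Layers of a stable set *)

(** For a finite [X], the inclusion [h + X \subset X] is an equality. *)
Definition stabilizer (G : finZmodType) (X : {set G}) : {set G} :=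
  [set h | [forall x in X, h + x \in X]].

Lemma stabilizerP (G : finZmodType) (X : {set G}) h :
  reflect (forall x, x \in X -> h + x \in X) (h \in stabilizer X).
Proof. by rewrite inE; apply: forall_inP. Qed.

Section Layers.
Variables (p n : nat) (p_prime : prime p) (p_gt2 : (2 < p)%N).
Local Notation V := 'rV['F_p]_n.
Local Notation e := (@basis_vec p n).
Local Notation low := (@low p n).
Implicit Types (X Y Z S : {set V}) (x y h : V) (i j : 'I_n) (k : nat).

Lemma low0 k : 0 \in low k.
Proof. by apply/lowP => i _; rewrite mxE. Qed.

Lemma lowD k x y : x \in low k -> y \in low k -> x + y \in low k.
Proof.
by move=> /lowP xk /lowP yk; apply/lowP => i ki; rewrite mxE xk ?yk ?addr0.
Qed.

Lemma lowZ k (c : 'F_p) x : x \in low k -> c *: x \in low k.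
Proof.
by move=> /lowP xk; apply/lowP => i ki; rewrite mxE xk ?mulr0.
Qed.

Lemma lowB k x y : x \in low k -> y \in low k -> x - y \in low k.
Proof. by move=> xk yk; rewrite -scaleN1r lowD ?lowZ. Qed.

Lemma low_leq k l : (k <= l)%N -> low k \subset low l.
Proof.
move=> kl; apply/fintype.subsetP => x /lowP xk; apply/lowP => i li.
by apply/xk/(leq_trans kl).
Qed.

Lemma low_basis k i : (i < k)%N -> e i \in low k.
Proof.
move=> ik; apply/lowP => i' ki'; rewrite basis_vecE.
by case: eqP => // ii'; rewrite ii' leqNgt ik in ki'.
Qed.

Lemma lowS j x : x \in low j.+1 -> x 0 j = 0 -> x \in low j.
Proof.
move=> /lowP xj x0; apply/lowP => i; rewrite leq_eqVlt => /orP[/eqP ji|/xj //].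
by rewrite -x0; congr (x 0 _); apply: val_inj.
Qed.

Lemma low_coord j x : x \in low j -> x 0 j = 0.
Proof. by move/lowP; apply. Qed.

Lemma basis_vec_diag j : e j 0 j = 1.
Proof. by rewrite basis_vecE eqxx. Qed.

Lemma low_n : low n = [set: V].
Proof.
by apply/setP => x; rewrite [RHS]inE; apply/lowP => i; rewrite leqNgt ltn_ord.
Qed.

Lemma low_0 : low 0 = [set 0].
Proof.
apply/setP => x; rewrite [RHS]inE; apply/lowP/eqP => [x0|-> i _].
  by apply/rowP => i; rewrite x0 // mxE.
by rewrite mxE.
Qed.

Lemma card_lowS j : #|low j.+1| = (p * #|low j|)%N.
Proof.
transitivity #|finset.setX [set: 'F_p] (low j)|; last first.
  by rewrite cardsX cardsT card_Fp.
pose f (tx : 'F_p * V) := tx.1 *: e j + tx.2.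
rewrite -(card_in_imset (f := f)) => [|[t x] [s y]].
  apply: eq_card => x; apply/idP/imsetP => [xj|[[t y]]].
    exists (x 0 j, x - x 0 j *: e j); last by rewrite /f /= addrC subrK.
    rewrite in_setX in_setT /=; apply: lowS; first by rewrite lowB ?lowZ ?low_basis.
    by rewrite !mxE !eqxx mulr1 subrr.
  rewrite in_setX in_setT /= => yj ->.
  by rewrite lowD ?lowZ ?low_basis // (fintype.subsetP (low_leq (leqnSn j))).
rewrite !in_setX !in_setT /= => /low_coord xj /low_coord yj; rewrite /f /= => E.
have ts : t = s.
  have := congr1 (fun z : V => z 0 j) E.
  by rewrite /= !mxE !eqxx !mulr1 xj yj !addr0.
by congr pair => //; move: E; rewrite ts => /addrI.
Qed.

Lemma card_low k : (k <= n)%N -> #|low k| = (p ^ k)%N.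
Proof.
elim: k => [|k IH] kn; first by rewrite low_0 cards1.
by rewrite (card_lowS (Ordinal kn)) /= IH ?expnS // ltnW.
Qed.

Lemma closed_low k X : 0 \in X -> (forall x y, x \in X -> y \in X -> x + y \in X) ->
  (forall i, (i < k)%N -> e i \in X) -> low k \subset X.
Proof.
move=> X0 XD Xe; apply/fintype.subsetP => x /lowP xk.
rewrite [x]row_sum_delta; elim/big_ind: _ => // i _.
have [ik|ki] := ltnP i k; last by rewrite xk // scale0r.
rewrite -(natr_Zp (x 0 i)) scaler_nat; elim: (nat_of_ord _) => [|c IH].
  by rewrite mulr0n.
by rewrite mulrS XD // Xe.
Qed.

(** The values 0, 1 and 2 of a coordinate are distinct because [p > 2]. *)
Lemma card_levels j S X Y Z : X \subset S -> Y \subset S -> Z \subset S ->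
  (forall x, x \in X -> x 0 j = 0) -> (forall x, x \in Y -> x 0 j = 1) ->
  (forall x, x \in Z -> x 0 j = 1 + 1) -> (#|X| + #|Y| + #|Z| <= #|S|)%N.
Proof.
move=> XS YS ZS X0 Y1 Z2.
have n20 : (1 + 1 : 'F_p) != 0.
  by rewrite -mulr2n -(dvdn_pcharf (pchar_Fp p_prime)) gtnNdvd.
have XY : X :&: Y = set0.
  apply/setP => x; rewrite !inE; apply/andP => -[/X0 x0 /Y1].
  by rewrite x0 => /eqP; rewrite eq_sym oner_eq0.
have XYZ : (X :|: Y) :&: Z = set0.
  apply/setP => x; rewrite !inE; apply/andP => -[/orP[/X0 x0|/Y1 x1] /Z2].
    by rewrite x0 => /eqP; rewrite eq_sym (negPf n20).
  by rewrite x1 -[X in X = _]addr0 => /addrI/eqP; rewrite eq_sym oner_eq0.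
have := cardsUI X Y; rewrite XY cards0 addn0 => <-.
have := cardsUI (X :|: Y) Z; rewrite XYZ cards0 addn0 => <-.
by rewrite subset_leq_card // !finset.subUset XS YS ZS.
Qed.

Variables (A : {set V}) (fA : framed A) (sA : stable A).

Definition sect k := A :&: low k.
Definition layer j := [set x in sect j.+1 | x 0 j == 1].

Lemma sectP k x : reflect (x \in A /\ x \in low k) (x \in sect k).
Proof. by rewrite in_setI; apply: andP. Qed.

Lemma sect0 k : 0 \in sect k.
Proof. by have /andP[A0 _] := fA; rewrite in_setI A0 low0. Qed.

Lemma sect_basis k i : (i < k)%N -> e i \in sect k.
Proof.
by move=> ik; have /andP[_ /forallP Ae] := fA; rewrite in_setI Ae low_basis.
Qed.

Lemma sect_leq k l : (k <= l)%N -> sect k \subset sect l.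
Proof. by move=> kl; rewrite setIS ?low_leq. Qed.

Lemma sectS j x : x \in sect j.+1 -> x 0 j = 0 -> x \in sect j.
Proof. by move=> /sectP[Ax xj] x0; apply/sectP; split=> //; apply: lowS. Qed.

Lemma sect_shift j x y :
  x \in sect j.+1 -> x 0 j != 0 -> y \in sect j -> x - e j + y \in sect j.+1.
Proof.
move=> /sectP[Ax xj] x0 /sectP[Ay yj]; apply/sectP; split; first exact: sA.
by rewrite lowD ?lowB ?low_basis // (fintype.subsetP (low_leq (leqnSn j))).
Qed.

Lemma coord_shift j x y : y \in low j -> (x - e j + y) 0 j = x 0 j - 1.
Proof.
by move=> /low_coord y0; rewrite !mxE y0 addr0 !eqxx.
Qed.

(** Stability with [y = 0] lowers the [j]-th coordinate one unit at a time. *)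
Lemma sect_level2 j x : x \in sect j.+1 -> x 0 j != 0 -> x 0 j != 1 ->
  exists2 z, z \in sect j.+1 & z 0 j = 1 + 1.
Proof.
move=> + x0 x1.
have [c cE cp] : exists2 c : nat, x 0 j = c.+2%:R & (c.+2 < p)%N.
  have := natr_Zp (x 0 j); move: x0 x1 (ltn_Fp (x 0 j) p_prime).
  rewrite -!val_eqE /=.
  by case: (nat_of_ord (x 0%R j)) => [|[|c]] // _ _ cp <-; exists c.
elim: c x cE cp {x0 x1} => [|c IH] x cE cp sx; first by exists x.
apply: (IH (x - e j + 0)); last 2 first.
- exact: ltnW.
- apply: sect_shift; rewrite ?sect0 // cE.
  by rewrite -(dvdn_pcharf (pchar_Fp p_prime)) gtnNdvd.
by rewrite coord_shift ?low0 // cE mulrSr addrK.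
Qed.

Lemma layer_stab j x : x \in layer j -> x - e j \in stabilizer (sect j).
Proof.
rewrite inE => /andP[sx /eqP x1]; apply/stabilizerP => y sy.
apply: sectS; first by rewrite sect_shift // x1 oner_eq0.
by rewrite coord_shift ?x1 ?subrr //; case/sectP: sy.
Qed.

(** A point at level 2 would give [d] with [d + A_j + A_j \subset A_j], by
    stability used twice.  Then [A_j] is closed under addition, and as it
    contains the first [j] basis vectors it is all of [low j]. *)
Lemma sect_coord j x : sect j != low j -> x \in sect j.+1 -> x 0 j = 0 \/ x 0 j = 1.
Proof.
move=> nj sx; have [?|x0] := eqVneq (x 0 j) 0; first by left.
have [?|x1] := eqVneq (x 0 j) 1; first by right.
have [z sz z2] := sect_level2 sx x0 x1.
pose d := z - e j - e j.
have dD y y' : y \in sect j -> y' \in sect j -> d + y + y' \in sect j.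
  move=> sy sy'; have [_ yj] := sectP _ _ sy.
  have z0 : z 0 j != 0.
    by rewrite z2 -mulr2n -(dvdn_pcharf (pchar_Fp p_prime)) gtnNdvd.
  have -> : d + y + y' = z - e j + y - e j + y'.
    by rewrite /d [z - e j + y - _]addrAC.
  have zy : z - e j + y \in layer j.
    by rewrite inE sect_shift //= coord_shift // z2 addrK.
  by have /stabilizerP/(_ _ sy') := layer_stab zy.
(* Counting upgrades [d + A_j \subset A_j] to an equality. *)
have dj : [set d + y | y in sect j] = sect j.
  apply/eqP; rewrite eqEcard card_imset ?leqnn ?andbT; last exact: addrI.
  apply/fintype.subsetP => _ /imsetP[y sy ->].
  by rewrite -[d + y]addr0 dD // sect0.
case/eqP: nj; apply/eqP; rewrite eqEsubset finset.subsetIr /=.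
apply: closed_low; [exact: sect0| |by move=> i; apply: sect_basis].
move=> y y' sy sy'; have := dD _ _ sy sy'; rewrite -{1}dj => /imsetP[y2 sy2].
by rewrite -addrA => /addrI ->.
Qed.

Lemma layerB_inj j : #|layer j| = #|[set x - e j | x in layer j]|.
Proof. by rewrite card_imset //; apply: addIr. Qed.

(** The levels 0, 1 and 2 of the sumset contain [A_j + A_j], [e_j + A_j] and
    [e_j + layer j] respectively. *)
Lemma sumset_step j :
  (#|sumset (sect j) (sect j)| + (#|sect j| + #|layer j|)
    <= #|sumset (sect j.+1) (sect j.+1)|)%N.
Proof.
rewrite addnA -(card_imset (mem (sect j)) (addrI (e j))).
rewrite -(card_imset (mem (layer j)) (addrI (e j))).
have sj := fintype.subsetP (sect_leq (leqnSn j)).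
have ej := sect_basis (ltnSn j).
apply: (@card_levels j).
- by apply/fintype.subsetP => _ /imset2P[x y /sj sx /sj sy ->]; apply: mem_sumset.
- by apply/fintype.subsetP => _ /imsetP[x /sj sx ->]; apply: mem_sumset.
- apply/fintype.subsetP => _ /imsetP[x + ->].
  by rewrite inE => /andP[sx _]; apply: mem_sumset.
- move=> _ /imset2P[x y /sectP[_ /low_coord x0] /sectP[_ /low_coord y0] ->].
  by rewrite mxE x0 y0 addr0.
- move=> _ /imsetP[x /sectP[_ /low_coord x0] ->].
  by rewrite mxE x0 basis_vec_diag addr0.
- move=> _ /imsetP[x + ->]; rewrite inE => /andP[_ /eqP x1].
  by rewrite mxE x1 basis_vec_diag.
Qed.

Lemma card_sectS j : (forall x, x \in sect j.+1 -> x 0 j = 0 \/ x 0 j = 1) ->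
  #|sect j.+1| = (#|sect j| + #|layer j|)%N.
Proof.
move=> lev.
have -> : sect j.+1 = sect j :|: layer j.
  apply/setP => x; rewrite [RHS]inE; apply/idP/orP => [sx|[]].
  - have [x0|x1] := lev x sx; first by left; apply: sectS.
    by right; rewrite inE sx x1 eqxx.
  - exact/fintype.subsetP/sect_leq.
  - by rewrite inE => /andP[].
have := cardsUI (sect j) (layer j).
suff -> : sect j :&: layer j = set0 by rewrite cards0 addn0.
apply/setP => x; rewrite in_setI in_set0; apply/andP => -[/sectP[_ /low_coord x0]].
by rewrite inE x0 eq_sym oner_eq0 andbF.
Qed.

Lemma stab_sect k h : h \in stabilizer (sect k) -> h \in sect k.
Proof. by move/stabilizerP/(_ 0 (sect0 k)); rewrite addr0. Qed.

Lemma stab_le_layer j : (forall h, h \in stabilizer (sect j.+1) -> h 0 j = 0) ->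
  (#|stabilizer (sect j.+1)| <= #|layer j|)%N.
Proof.
move=> h0; rewrite -(card_imset _ (addIr (e j))); apply/subset_leq_card.
apply/fintype.subsetP => _ /imsetP[h hS ->]; rewrite inE.
rewrite (stabilizerP _ _ hS) ?sect_basis // mxE h0 // add0r.
by rewrite basis_vec_diag eqxx.
Qed.

(** If [h] stabilizes [A_(j+1)], then [h] is in [A_(j+1)], at level 0 or 1; level
    1 is excluded because [h + e_j] would be at level 2.  So [h] stabilizes
    [A_j], and [h + e_j] is in the layer. *)
Lemma layer_recurrence j : sect j != low j ->
  [/\ #|sect j.+1| = (#|sect j| + #|layer j|)%N,
      (#|layer j| <= #|stabilizer (sect j)|)%N,
      (#|stabilizer (sect j.+1)| <= #|stabilizer (sect j)|)%N &
      (#|stabilizer (sect j.+1)| <= #|layer j|)%N].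
Proof.
move=> nj; have lev x := @sect_coord j x nj.
have h0 h : h \in stabilizer (sect j.+1) -> h 0 j = 0.
  move=> hS; have [//|h1] := lev h (stab_sect hS).
  have /lev := stabilizerP _ _ hS _ (sect_basis (ltnSn j)).
  rewrite mxE h1 basis_vec_diag => -[/eqP|].
    by rewrite -mulr2n -(dvdn_pcharf (pchar_Fp p_prime)) gtnNdvd.
  by rewrite -[X in _ = X]addr0 => /addrI/eqP; rewrite oner_eq0.
split; first exact: card_sectS.
- rewrite layerB_inj; apply/subset_leq_card/fintype.subsetP => _ /imsetP[x xl ->].
  exact: layer_stab.
- apply/subset_leq_card/fintype.subsetP => h hS; apply/stabilizerP => y sy.
  apply: sectS.
    by apply: (stabilizerP _ _ hS); apply/fintype.subsetP/sect_leq: y sy.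
  by have [_ /low_coord y0] := sectP _ _ sy; rewrite mxE y0 h0 ?addr0.
exact: stab_le_layer.
Qed.
End Layers.

(** * Structure of a stable set *)

(** A finite additive group is read here as a group whose product is [+%R], so
    that Lagrange's theorem applies to stabilizers. *)
Lemma group_set_stabilizer (G : finZmodType) (X : {set G}) :
  group_set (stabilizer X).
Proof.
apply/group_setP; split; first by apply/stabilizerP => x Xx; rewrite add0r.
move=> g h /stabilizerP gX /stabilizerP hX; apply/stabilizerP => x Xx.
by rewrite -[_ + x]addrA gX ?hX.
Qed.

Lemma proper_subgroup_card (G : finZmodType) (S H : {set G}) p k :
    prime p -> #|H| = (p ^ k)%N -> group_set S -> group_set H ->
  S \proper H -> (p * #|S| <= #|H|)%N.
Proof.
move=> pp cH gS gH SH.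
have : (#|S| %| #|H|)%N.
  by apply: (@cardSg _ (Group gH) (Group gS)); apply: proper_sub.
have := proper_card SH; rewrite cH => + /(dvdn_pfactor _ _ pp)[l lk cS].
rewrite cS -expnS ltn_exp2l ?prime_gt1 // => lt.
by rewrite leq_exp2l ?prime_gt1.
Qed.

Section Structure.
Variables (p n : nat) (p_prime : prime p) (p_gt2 : (2 < p)%N).
Local Notation V := 'rV['F_p]_n.
Local Notation e := (@basis_vec p n).
Local Notation low := (@low p n).
Variables (A : {set V}) (fA : framed A) (sA : stable A).
Local Notation sect := (sect A).
Local Notation layer := (layer A).
Local Notation stab k := (stabilizer (sect k)).
Implicit Types (x y h : V) (i j : 'I_n) (k l m : nat).

Lemma group_set_low k : group_set (low k).
Proof. by apply/group_setP; split=> [|x y]; [exact: low0 | exact: lowD]. Qed.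

(** Otherwise the multiples of [h] would carry the full section [low j] onto
    all of [low j.+1]. *)
Lemma stab_first j h : sect j = low j -> sect j.+1 != low j.+1 ->
  h \in stab j.+1 -> h 0 j = 0.
Proof.
move=> sj nj hS; apply: contraNeq nj => h0.
rewrite eqEsubset finset.subsetIr /=; apply/fintype.subsetP => x xj.
have hj : h \in low j.+1 by have /sectP[] := stab_sect fA hS.
have key c : h *+ c + (x - (x 0 j / h 0 j) *: h) \in sect j.+1.
  elim: c => [|c IH]; last by rewrite mulrS -addrA (stabilizerP _ _ hS).
  rewrite mulr0n add0r; apply: (fintype.subsetP (sect_leq A (leqnSn j))).
  rewrite sj; apply: lowS; first by rewrite lowB ?lowZ.
  by rewrite !mxE divfK // subrr.
have := key (x 0 j / h 0 j : 'F_p).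
by rewrite -scaler_nat natr_Zp addrC subrK.
Qed.

Lemma layer_le j : (#|layer j| <= #|low j|)%N.
Proof.
rewrite layerB_inj; apply/subset_leq_card/fintype.subsetP => _ /imsetP[x + ->].
rewrite inE => /andP[/sectP[_ xj] /eqP x1]; apply: lowS.
  by rewrite lowB ?low_basis.
by rewrite mxE x1 mxE basis_vec_diag subrr.
Qed.

(** Above a full section, stability makes every level below a nonempty level
    full.  So either level 1 is not full and is the last one, or level 1 is
    full and is the last one, or level 1 is full and level 2 is not empty.  In
    the first case the stabilizer is a proper subgroup of [low j], which saves
    a factor [p]; in the third, level 2 is a union of cosets of it. *)
Lemma first_layer j : sect j = low j -> sect j.+1 != low j.+1 ->
  [/\ (#|stab j.+1| <= #|low j|)%N, (#|layer j| <= #|low j|)%N &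
    [\/ [/\ #|sect j.+1| = (#|low j| + #|layer j|)%N,
            (#|stab j.+1| <= #|layer j|)%N & (p * #|stab j.+1| <= #|low j|)%N],
        #|layer j| = #|low j| /\ #|sect j.+1| = (#|low j| + #|low j|)%N |
        #|layer j| = #|low j| /\
        (#|low j| + #|low j| + #|stab j.+1| <= #|sect j.+1|)%N]].
Proof.
move=> sj nj; have h0 h := @stab_first j h sj nj.
have stab_low : stab j.+1 \subset low j.
  apply/fintype.subsetP => h hS; apply: lowS; last exact: h0.
  by have /sectP[] := stab_sect fA hS.
split; [exact: subset_leq_card | exact: layer_le | ].
have := layer_le j; rewrite leq_eqVlt => /orP[/eqP uq|uq].
  have [/existsP[x /andP[sx]]|/existsPn nx] :=
      boolP [exists x in sect j.+1, (x 0 j != 0) && (x 0 j != 1)].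
    case/andP=> x0 x1; apply: Or33; split=> //.
    have [z sz z2] := sect_level2 p_prime fA sA sx x0 x1.
    rewrite -{2}uq -(card_imset _ (addIr z)).
    apply: (card_levels p_prime p_gt2 (j := j)).
    - by rewrite -sj sect_leq.
    - by apply/fintype.subsetP => x'; rewrite inE => /andP[].
    - apply/fintype.subsetP => _ /imsetP[h hS ->].
      exact: (stabilizerP _ _ hS).
    - by move=> x' /low_coord.
    - by move=> x'; rewrite inE => /andP[_ /eqP].
    - by move=> _ /imsetP[h /h0 h00 ->]; rewrite mxE h00 add0r.
  apply: Or32; split => //; rewrite -{2}uq -sj; apply: card_sectS => // x sx.
  have := nx x; rewrite sx /= negb_and !negbK => /orP[] /eqP; first by left.
  by right.
apply: Or31.
have lev x : x \in sect j.+1 -> x 0 j = 0 \/ x 0 j = 1.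
  move=> sx; have [?|x0] := eqVneq (x 0 j) 0; first by left.
  have [?|x1] := eqVneq (x 0 j) 1; first by right.
  have [z sz z2] := sect_level2 p_prime fA sA sx x0 x1.
  (* A point at level 2 would fill level 1, by stability. *)
  move: uq; rewrite ltnNge => /negP[]; rewrite -(card_imset _ (addrI (z - e j))).
  apply/subset_leq_card/fintype.subsetP => _ /imsetP[y yj ->].
  have z0 : z 0 j != 0.
    by rewrite z2 -mulr2n -(dvdn_pcharf (pchar_Fp p_prime)) gtnNdvd.
  by rewrite inE sect_shift // ?sj // coord_shift // z2 addrK.
split; [by rewrite card_sectS // sj | exact: stab_le_layer | ].
apply: (proper_subgroup_card p_prime (card_low p_prime (ltnW (ltn_ord j)))).
- exact: group_set_stabilizer.
- exact: group_set_low.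
rewrite properE stab_low; apply: contraL uq => lowS; rewrite -leqNgt.
by apply: leq_trans (stab_le_layer fA h0); apply: subset_leq_card.
Qed.

Lemma sect_neq_leq k l : (k <= l)%N -> sect k != low k -> sect l != low l.
Proof.
move=> kl; apply: contraNneq => sl; rewrite eqEsubset finset.subsetIr /=.
rewrite finset.subsetI subxx andbT.
by apply: fintype.subset_trans (low_leq p n kl) _; rewrite -sl finset.subsetIl.
Qed.

(** Here [t] is the total size of the layers above [l].  The layers decrease,
    because each lies in the stabilizer of the section below and contains a
    copy of the next stabilizer; the i-th of them is counted [m + 1 - i] times
    in the sumset, so by Chebyshev's sum inequality they contribute at least
    [(m + 1) t / 2].  The bound on [m * #|stabilizer|] carries the monotonicity
    through the induction. *)
Lemma upper_layers l m : sect l != low l -> (l + m <= n)%N ->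
  exists t, [/\ #|sect (l + m)| = (#|sect l| + t)%N,
    (t <= m * #|stab l|)%N, (m * #|stab (l + m)| <= t)%N,
    (#|stab (l + m)| <= #|stab l|)%N &
    (2 * #|sumset (sect l) (sect l)| + 2 * m * #|sect l| + m.+1 * t
      <= 2 * #|sumset (sect (l + m)) (sect (l + m))|)%N].
Proof.
move=> nl; elim: m => [|m IH] lm.
  by exists 0%N; rewrite !addn0; split; lia.
have [|t [at_ tw wt ws st]] := IH; first by lia.
have lt : (l + m < n)%N by lia.
pose j := Ordinal lt.
have nj : sect j != low j by apply: sect_neq_leq nl; apply: leq_addr.
have [a1 b1 c1 d1] := layer_recurrence p_prime p_gt2 fA sA nj.
have s1 := sumset_step p_prime p_gt2 fA j.
rewrite addnS; move: a1 b1 c1 d1 s1; rewrite /j /= -/j => a1 b1 c1 d1 s1.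
exists (t + #|layer j|)%N.
have mS := leq_mul (leqnn m) c1; have mL := leq_mul (leqnn m) b1.
move: a1 b1 c1 d1 s1 at_ tw wt ws st mS mL.
move: #|layer j| #|sect (l + m).+1| #|sect (l + m)| #|stab (l + m)| => L a' a s.
move: #|stab (l + m).+1| #|stab l| #|sect l| => s' w b.
move: #|sumset (sect (l + m).+1) _| #|sumset (sect (l + m)) _| => S' S.
move: #|sumset _ _| => B -> Ls s's s'L S'B aE tw wt ws st mS mL.
by split; rewrite -?mulnA ?mulnDr ?mulSn in st *; lia.
Qed.
End Structure.

(** * Numerical estimates *)

Section Estimates.
Variable R : realType.

Lemma expR1_le3 : expR 1 <= 3 :> R.
Proof.
(* [1 / e <= 1 / 3] follows from [(1 - 1 / 6) ^+ 6 >= 1 / 3]. *)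
have h : 5 / 6 <= expR (- (1 / 6)) :> R.
  by apply: le_trans (expR_ge1Dx _); lra.
have : (5 / 6) ^+ 6 <= expR (- 1) :> R.
  have -> : - 1 = 6%:R * - (1 / 6) :> R by lra.
  rewrite expRM_natl lerXn2r ?nnegrE ?expR_ge0 //; lra.
rewrite expRN => h2; rewrite -[expR 1]invrK -[3]invrK.
rewrite lef_pV2 ?posrE ?invr_gt0 ?expR_gt0 //.
by apply: le_trans h2; lra.
Qed.

Lemma powR_ge1D (a y : R) : 3 <= a -> 0 <= y -> 1 + y <= a `^ y.
Proof.
move=> a3 y0; have a0 : 0 < a by lra.
apply: le_trans (expR_ge1Dx y) _.
have ea : expR 1 <= a by apply: le_trans expR1_le3 a3.
have -> : expR y = expR 1 `^ y by rewrite -expRM mul1r.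
by apply: ge0_ler_powR; rewrite ?nnegrE ?expR_ge0 // ltW.
Qed.

(** Half of the quadratic term of the exponential series is enough below; it
    comes from squaring the linear bound at [y / 2]. *)
Lemma powR_ge_sqr (a y : R) : 3 <= a -> 0 <= y -> 1 + y + y ^+ 2 / 4 <= a `^ y.
Proof.
move=> a3 y0; have -> : y = y / 2 * 2 by lra.
rewrite powRrM powR_mulrn ?powR_ge0 //.
have := @powR_ge1D a (y / 2) a3; set z := _ `^ _ => h.
have {h} : 1 + y / 2 <= z by apply: h; lra.
by move=> ?; nra.
Qed.

Lemma small_codim (P X q D m : R) : 0 <= q -> q <= D -> m <= 7 -> 13 - m <= X ->
  1 + X + X ^+ 2 / 4 <= P -> q * (X + m + 2) <= P * D.
Proof.
move=> q0 qD m7 mX XP.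
have X6 : 6 <= X by lra.
have h : X + m + 2 <= P by nra.
by rewrite mulrC ler_pM //; nra.
Qed.

Lemma large_product (P X q D m : R) : 0 <= X -> 0 <= D ->
    4 * q <= X * D -> (m + 2) * q <= D + X * D ->
  1 + X + X ^+ 2 / 4 <= P -> q * (X + m + 2) <= P * D.
Proof.
move=> X0 D0 h1 h2 XP; apply: le_trans (ler_wpM2r D0 XP).
have := ler_wpM2l X0 h1; nra.
Qed.

(** [q] stands for the size of the largest full section, [b] and [s0] for those
    of the next section and of its sumset, [u] for that of its level 1,
    [w] for that of its stabilizer, [m] for the number of remaining coordinates,
    [t] for the total size of their layers, [D] and [s] for the sizes of the set
    and of its sumset, and [P] for p^X.

    Since [s <= K D], the number [X D] is at least [2 s0 + (m - 3) b - 2 t].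
    For [m >= 8], in the first and third cases, this gives [X D >= 4 q] and
    [D + X D >= (m + 2) q], and the quadratic bound on [P] concludes.  In the
    second case, which contains the extremal sets, put [d = m q - t]: then
    [D = (m + 2) q - d], while [X D] is at least [2 d] and at least [2 q X], so
    that [P >= 1 + X] is enough. *)
Lemma density_estimate (P K m q u w b t D s0 s : R) :
    8 <= K -> 0 < q -> 0 <= m -> m <= 7 \/ 8 <= m ->
    0 <= u -> 0 <= w -> 0 <= t -> w <= q ->
    2 * q + u <= s0 -> D = b + t -> t <= m * w ->
    2 * s0 + 2 * m * b + (m + 1) * t <= 2 * s -> s <= K * D ->
    [\/ [/\ b = q + u, w <= u & 3 * w <= q], u = q /\ b = q + q
      | u = q /\ q + q + w <= b] ->
    (forall X, X = 2 * K - 3 - m -> 0 <= X -> 1 + X + X ^+ 2 / 4 <= P) ->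
  q * (2 * K - 1) <= P * D.
Proof.
move=> K8 q0 m0 m78 u0 w0 t0 wq hs0 DE tw hs sK cases HP.
pose X := 2 * K - 3 - m.
have -> : 2 * K - 1 = X + m + 2 by rewrite /X; lra.
have bq : q <= b by case: cases => [[]|[]|[]]; lra.
have Dq : q <= D by lra.
have D0 : 0 < D by lra.
have XD : 2 * s0 + (m - 3) * b - 2 * t <= X * D.
  have -> : X * D = 2 * (K * D) - (3 + m) * D by rewrite /X; ring.
  by rewrite {2}DE; nra.
case: m78 => [m7|m8].
  have X0 : 0 <= X by rewrite /X; lra.
  by apply: (@small_codim _ X) => //; [lra | rewrite /X; lra | apply: HP].
have Xpos : 0 <= X * D -> 0 <= X by rewrite pmulr_lge0.
have wm : w * m <= q * m by apply: ler_wpM2r.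
case: cases => [[bE wu wq3]|[uq bE]|[uq bE]].
- have mu : m * w <= m * u by apply: ler_wpM2l.
  have mw : m * (3 * w) <= m * q by apply: ler_wpM2l.
  have h1 : (m + 1) * q + (m - 1) * u - 2 * t <= X * D.
    by apply: le_trans XD; rewrite bE; nra.
  have mq : 8 * q <= m * q by apply: ler_wpM2r; lra.
  have h4 : 4 * q <= X * D by apply: le_trans h1; nra.
  have X0 : 0 <= X by apply: Xpos; lra.
  apply: (large_product X0) => //; [exact: ltW | | exact: HP].
  by rewrite DE in h1 *; nra.
- have h1 : 2 * (m * q - t) <= X * D.
    by apply: le_trans XD; rewrite bE; nra.
  have X0 : 0 <= X by apply: Xpos; nra.
  have XP : 1 + X <= P by have := HP X erefl X0; have := sqr_ge0 X; lra.
  apply: le_trans (ler_wpM2r (ltW D0) XP).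
  have h2 : X * (2 * q) <= X * D by apply: ler_wpM2l => //; lra.
  by lra.
- have mb : (m - 3) * (2 * q + w) <= (m - 3) * b by apply: ler_wpM2l; lra.
  have mq : 8 * q <= m * q by apply: ler_wpM2r; lra.
  have h1 : 2 * m * q - (m + 3) * w <= X * D by apply: le_trans XD; nra.
  have h4 : 4 * q <= X * D by apply: le_trans h1; nra.
  have X0 : 0 <= X by apply: Xpos; lra.
  apply: (large_product X0) => //; [exact: ltW | | exact: HP].
  by nra.
Qed.
End Estimates.

(** * The bound on the affine span *)

Lemma framed_bound (R : realType) (p n : nat) (K : R) (A : {set 'rV['F_p]_n}) :
    prime p -> (2 < p)%N -> 8 <= K -> framed A ->
    #|sumset A A|%:R <= K * #|A|%:R ->
  (p ^ n)%:R / #|A|%:R <= p%:R `^ (2 * K - 2) / (2 * K - 1).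
Proof.
move=> pp p2 K8 /exists_stable-/(_ pp)[B [fB <- sBA sB]] hK.
have {sBA}hK : #|sumset B B|%:R <= K * #|B|%:R.
  by apply: le_trans hK; rewrite ler_nat.
have p3 : 3 <= p%:R :> R by rewrite ler_nat.
have B0 : (0 < #|B|)%N by apply/card_gt0P; exists 0; case/andP: fB.
have BE : sect B n = B by rewrite /sect low_n finset.setIT.
rewrite ler_pdivrMr ?ltr0n // mulrAC ler_pdivlMr; last by lra.
have [Bn|nBn] := eqVneq (sect B n) (low p n n).
  rewrite -(card_low pp (leqnn n)) -Bn BE mulrC ler_wpM2r //.
  by apply: le_trans (powR_ge1D p3 _); lra.
have exl : exists l, sect B l != low p n l by exists n.
have := ex_minnP exl; case=> -[|j] nl minl.
  case/eqP: nl; apply/setP => x; apply/sectP/idP => [[]//|x0]; split=> //.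
  by move: x0; rewrite low_0 => /finset.set1P ->; case/andP: fB.
have jn : (j < n)%N by apply: minl.
pose i := Ordinal jn.
have sj : sect B j = low p n j.
  by apply/eqP; apply: contraT => /minl; rewrite ltnn.
have [wq uq cases] := @first_layer p n pp p2 B fB sB i sj nl.
have step := sumset_step pp p2 fB i.
have [t [cB tw _ _ st]] := upper_layers pp p2 fB sB nl (m := n - j.+1)
   (eq_leq (subnKC jn)).
move: cB st; rewrite subnKC // BE; set m := (n - j.+1)%N => cB st.
have -> : (p ^ n)%N = (#|low p n j| * p ^ m.+1)%N.
  by rewrite (card_low pp (ltnW jn)) -expnD addnS -addSn subnKC.
have p0 : 0 < p%:R :> R by lra.
have -> : p%:R `^ (2 * K - 2) = p%:R `^ (2 * K - 3 - m%:R) * (p ^ m.+1)%:R :> R.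
  rewrite natrX -powR_mulrn ?ltW // -powRD; last by rewrite (lt0r_neq0 p0) implybT.
  by congr (_ `^ _); rewrite -addn1 natrD; ring.
rewrite natrM mulrAC [X in _ <= X]mulrAC ler_wpM2r //.
have lowj : (0 < #|low p n j|)%N by apply/card_gt0P; exists 0; apply: low0.
apply: (@density_estimate R _ K m%:R _ #|layer B i|%:R #|stabilizer (sect B j.+1)|%:R
   #|sect B j.+1|%:R t%:R _ #|sumset (sect B j.+1) (sect B j.+1)|%:R
   #|sumset B B|%:R); rewrite ?ltr0n ?ler0n //.
- by have [?|?] := leqP m 7; [left|right]; rewrite ler_nat.
- by rewrite ler_nat.
- rewrite -natrM -natrD ler_nat; apply: leq_trans step.
  have : (#|low p n j| <= #|sumset (sect B i) (sect B i)|)%N.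
    rewrite -sj; apply/subset_leq_card/fintype.subsetP => x xj.
    by rewrite -[x]addr0 mem_sumset ?sect0.
  by rewrite -sj /=; lia.
- by rewrite cB natrD.
- by rewrite -natrM ler_nat.
- by rewrite natr1 -!natrM -!natrD ler_nat.
- case: cases => [[bE wu pw]|[uE bE]|[uE bE]].
  + apply: Or31; split; rewrite ?ler_nat ?bE ?natrD //.
    by rewrite -natrM ler_nat; apply: leq_trans pw; rewrite leq_mul2r p2 orbT.
  + by apply: Or32; rewrite -uE bE natrD uE.
  + by apply: Or33; rewrite -!natrD ler_nat uE.
by move=> X -> X0; apply: powR_ge_sqr.
Qed.

Lemma exists_frame (F : fieldType) (k n : nat) (C : 'M[F]_(k, n)) :
  exists (d : nat) (M : 'M[F]_(d, n)), [/\ row_free M, (C <= M)%MS &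
    forall i, exists i', row i M = row i' C].
Proof.
exists (\rank C), (rowsub (maxrankfun C) C); split.
- exact: maxrowsub_free.
- by rewrite eq_maxrowsub.
- by move=> i; exists (maxrankfun C i); apply/rowP => l; rewrite !mxE.
Qed.

(** Independent differences [a - a0] spanning all of them are the rows of [M], so
    [x |-> a0 + x M] is an affine embedding of F_p^d whose image is the affine
    span of [A], and the preimage of [A] contains the standard frame. *)
Lemma span_bound (R : realType) (p n : nat) (K : R) (A : {set 'rV['F_p]_n}) :
    prime p -> (2 < p)%N -> 8 <= K -> A != set0 ->
    #|sumset A A|%:R <= K * #|A|%:R ->
  #|affine_span A|%:R / #|A|%:R <= p%:R `^ (2 * K - 2) / (2 * K - 1).
Proof.
move=> pp p2 K8 /set0Pn[a0 Aa0] hK.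
pose C : 'M['F_p]_(#|A|, n) := \matrix_(i < #|A|) (enum_val i - a0).
have [d [M [Mfree CM MC]]] := exists_frame C.
pose f (x : 'rV['F_p]_d) := a0 + x *m M.
have f_inj : injective f by move=> x y /addrI; apply: row_free_inj.
pose A' := f @^-1: A.
have AE : A = [set f x | x in A'].
  apply/setP => a; apply/idP/imsetP => [Aa|[x]]; last by rewrite inE => ? ->.
  have : (a - a0 <= M)%MS.
    apply: submx_trans CM; have := row_sub (enum_rank_in Aa0 a) C.
    by rewrite rowK enum_rankK_in.
  case/submxP => x xE; exists x; last by rewrite /f -xE addrC subrK.
  by rewrite inE /f -xE addrC subrK.
have cA : #|A'| = #|A| by rewrite AE card_imset.
have fA' : framed A'.
  rewrite /framed inE /f mul0mx addr0 Aa0; apply/forallP => i.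
  rewrite inE /f /basis_vec -rowE; have [i' ->] := MC i.
  by rewrite rowK addrC subrK enum_valP.
have sA' : (#|sumset A' A'| <= #|sumset A A|)%N.
  pose g (x : 'rV['F_p]_d) := a0 + f x.
  rewrite -(card_imset (f := g)) => [|x y /addrI/f_inj //].
  apply/subset_leq_card/fintype.subsetP => _ /imsetP[_ /imset2P[x y xA yA ->] ->].
  have -> : g (x + y) = f x + f y by rewrite /g /f mulmxDl addrACA !addrA.
  by rewrite mem_sumset //; [move: xA | move: yA]; rewrite inE.
have spanA : (#|affine_span A| <= p ^ d)%N.
  have -> : (p ^ d = #|[set f x | x : 'rV['F_p]_d]|)%N.
    by rewrite card_imset // card_mx card_Fp // mul1n.
  apply/subset_leq_card/finset.bigcap_inf.
  have gH : group_set [set x *m M | x : 'rV['F_p]_d].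
    apply/group_setP; split; first by apply/imsetP; exists 0; rewrite ?mul0mx.
    move=> _ _ /imsetP[x _ ->] /imsetP[y _ ->].
    by apply/imsetP; exists (x + y); rewrite ?mulmxDl.
  apply/andP; split.
    apply/existsP; exists (Group gH); apply/existsP; exists a0; apply/eqP/setP => z.
    apply/imsetP/imsetP => [[x _ ->]|[_ /imsetP[x _ ->] ->]]; last by exists x.
    by exists (x *m M) => //; apply/imsetP; exists x.
  rewrite {1}AE; apply/fintype.subsetP => _ /imsetP[x _ ->].
  by apply/imsetP; exists x.
apply: le_trans (framed_bound pp p2 K8 fA' _); rewrite cA.
  by rewrite ler_wpM2r ?invr_ge0 // ler_nat.
by apply: le_trans hK; rewrite ler_nat.
Qed.

Theorem theorem3 (R : realType) (p : nat) (K : R)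
  (p_prime : prime p) (p_gt2 : (2 < p)%N) (K_ge8 : 8 <= K) :
  (F p K <= ((p%:R `^ (2 * K - 2)) / (2 * K - 1))%:E)%E.
Proof.
(* ['F_p] is by definition ['Z_(pdiv p)]. *)
rewrite -{1}(pdiv_id p_prime); apply: ge_ereal_sup => _ [n [A [A0 hK ->]]].
rewrite lee_fin; apply: (@span_bound R p n K A) => //.
by rewrite -ler_pdivrMr // ltr0n card_gt0.
Qed.
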